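(* (i) For any odd integer $n>1$, we have $$T(n):=\operatorname{per}\left[\tan\pi\frac{j+k}{n}\right]_{1\le j,k\le n-1}\in\mathbb Z.$$ (ii) Let $p$ be an odd prime. Then $$T(p)\equiv(-1)^{(p+1)/2}\,2p\pmod{p^2}.$$
   Context: The permanent of an $N\times N$ matrix $A=[a_{j,k}]$ is $\operatorname{per}(A)=\sum_{\tau\in S_N}\prod_{j=1}^{N}a_{j,\tau(j)}$. Here $\tan\pi\frac{m}{n}$ means $\tan(\pi m/n)$. *)

(* Defs.v *)
From HB Require Import structures.
From mathcomp Require Import all_boot all_order all_algebra all_fingroup.
From mathcomp Require Import all_classical all_reals all_analysis.
Set Implicit Arguments.
Unset Strict Implicit.
Unset Printing Implicit Defensive.
Import Order.TTheory GRing.Theory Num.Theory.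
Local Open Scope ring_scope.

Definition permanent (R : comPzSemiRingType) (N : nat) (A : 'M[R]_N) : R :=
  \sum_(s : 'S_N) \prod_(j < N) A j (s j).

(* Ordinals start at 0, so row i and column j of the matrix carry the
   1-based indices i.+1 and j.+1. *)
Definition tan_matrix (R : realType) (n : nat) : 'M[R]_(n.-1) :=
  \matrix_(i < n.-1, j < n.-1) tan (pi * ((i.+1 + j.+1)%:R / n%:R)).

Definition T (R : realType) (n : nat) : R := permanent (tan_matrix R n).

(* Main.v *)
Require Import Defs.
From HB Require Import structures.
From mathcomp Require Import all_boot all_order all_algebra all_fingroup.
From mathcomp Require Import all_classical all_reals all_analysis.
From mathcomp Require Import finfield cyclotomic.
From mathcomp Require Import complex.
From mathcomp Require Import ring lra zify.
Set Implicit Arguments.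
Unset Strict Implicit.
Unset Printing Implicit Defensive.
Import Order.TTheory GRing.Theory Num.Theory.
Local Open Scope ring_scope.

(** Let z = e^(2 pi i / n) with n odd.  From
      i tan (pi m / n) = (z^m - 1) / (z^m + 1)
    and 1 / (z^m + 1) = 1 + z^(2m) + z^(4m) + ... + z^((n-1)m) for z^m != 1
    ((n+1)/2 terms, because z^m = (z^(2m))^((n+1)/2)), one gets
    i tan (pi m / n) = g(z^m) for the integer polynomial [tan_poly n]:
      g = (X - 1) (1 + X^2 + ... + X^(n-1)).
    Hence i^(n-1) T(n) = P(z), where P ([tan_permanent n]) is the permanent of
    the matrix of the polynomials g(X^(j+k)).

    Integrality.  Replacing z by a conjugate z^a, with a prime to n, permutes
    rows and columns by j |-> a j, so that P takes the same value at all
    primitive n-th roots of unity ([permanent_hankel_dilation]).  The remainder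
    of P modulo the monic integer polynomial Phi_n has degree less than the
    number of these roots, so it is a constant integer c
    ([const_on_conjugates]): P = c + U Phi_n in Z[X], and P(z) = c.  As n - 1 is
    even, T(n) is c up to sign ([permanent_tan_matrix]).

    Congruence.  For n = p prime every entry of P is divisible by X - 1, so
    P = (X - 1)^(p-1) H = c + U Phi_p.  At X = 1 this reads c = - p U(1).
    Modulo p, where Phi_p = (X - 1)^(p-1) and c = 0, it gives H = U, so
    c = - p H(1) modulo p^2 ([constant_mod_Cyclotomic_prime]).  Finally
    g / (X - 1) takes the value (p+1)/2 at 1, and H(1) is the permanent of the
    matrix of the (j + k) (p+1)/2; the factor ((p+1)/2)^(p-1) is 1 modulo p
    by Fermat, and the permanent of the matrix of the j + k is 2 modulo p
    ([permanent_hankel_Fp]). *)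

(** * Permanents *)

Lemma permanent_map (A B : comPzSemiRingType) (f : {rmorphism A -> B}) N
  (M : 'M[A]_N) : permanent (map_mx f M) = f (permanent M).
Proof.
rewrite /permanent rmorph_sum; apply: eq_bigr => s _.
by rewrite rmorph_prod; apply: eq_bigr => j _; rewrite mxE.
Qed.

Lemma permanent_scale (A : comPzRingType) N a (M : 'M[A]_N) :
  permanent (a *: M) = a ^+ N * permanent M.
Proof.
rewrite /permanent mulr_sumr; apply: eq_bigr => s _.
under eq_bigr do rewrite mxE.
by rewrite big_split /= prodr_const card_ord.
Qed.

Lemma permanent_mxsub (A : comPzSemiRingType) N (s t : 'S_N) (M : 'M[A]_N) :
  permanent (mxsub s t M) = permanent M.
Proof.
rewrite /permanent [RHS](reindex_inj (mulIg t)) /=.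
rewrite [RHS](reindex_inj (mulgI (s^-1)%g)) /=.
apply: eq_bigr => u _; rewrite [RHS](reindex_perm s).
by apply: eq_bigr => j _; rewrite mxE !permM permK.
Qed.

(** Multiplication by a unit modulo [n], as a permutation of 1, ..., n-1 shifted
    to the index set 0, ..., n-2. *)
Lemma mul_mod_perm n a : (1 < n)%N -> coprime a n ->
  exists s : 'S_(n.-1), forall j, (s j).+1 = (a * j.+1 %% n)%N.
Proof.
move=> n_gt1 co_an; have n_gt0 := ltnW n_gt1.
have nz (j : 'I_(n.-1)) : (0 < a * j.+1 %% n)%N.
  rewrite lt0n -/(n %| _)%N Gauss_dvdr 1?coprime_sym //.
  by rewrite gtnNdvd // -ltn_predRL.
have lt_n (j : 'I_(n.-1)) : ((a * j.+1 %% n).-1 < n.-1)%N.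
  by rewrite -ltnS !prednK ?nz // ltn_pmod.
have inj : injective (fun j => Ordinal (lt_n j)).
  move=> i j /(congr1 val) /= eq_ij; apply: val_inj => /=.
  have {eq_ij} : (a * i.+1 = a * j.+1 %[mod n])%N.
    by rewrite -(prednK (nz i)) -(prednK (nz j)) eq_ij.
  wlog le_ij : i j / (i <= j)%N.
    by move=> IH; case: (leqP i j) => [/IH//|/ltnW/IH IH' /esym/IH'].
  move/eqP; rewrite eq_sym eqn_mod_dvd ?leq_mul2l ?ltnS ?le_ij ?orbT //.
  rewrite -mulnBr Gauss_dvdr 1?coprime_sym // subSS => n_dvd.
  case: (posnP (j - i)%N) => [|ji_gt0]; first by move: le_ij => /=; lia.
  by have := dvdn_leq ji_gt0 n_dvd; have := ltn_ord j; lia.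
by exists (perm inj) => j; rewrite permE /= prednK.
Qed.

(** Rows and columns are indexed from 1 to n-1, hence the successors. *)
Definition hankel (A : Type) n (f : nat -> A) : 'M[A]_(n.-1) :=
  \matrix_(i, j) f (i.+1 + j.+1)%N.

(** Multiplying the index sums by [a] amounts to permuting rows and columns
    simultaneously by multiplication by [a] modulo [n]. *)
Lemma permanent_hankel_dilation (A : comPzSemiRingType) n a (f : nat -> A) :
  (1 < n)%N -> coprime a n -> (forall m, f (m %% n)%N = f m) ->
  permanent (hankel n (fun m => f (a * m)%N)) = permanent (hankel n f).
Proof.
move=> n_gt1 co_an fmod; have [s sE] := mul_mod_perm n_gt1 co_an.
rewrite -[RHS](permanent_mxsub s s); congr permanent; apply/matrixP => i j.
by rewrite !mxE !sE -[RHS]fmod modnDm fmod mulnDr.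
Qed.

(** * Integer polynomials at the primitive roots of unity *)

(** Both sides obey the same recursion: their products over the divisors of
    [n] are 'X^n - 1. *)
Lemma map_Cyclotomic (F : fieldType) n (z : F) :
  n.-primitive_root z -> map_poly intr 'Phi_n = cyclotomic z n.
Proof.
elim/ltn_ind: n z => n IHn z prim_z; have n_gt0 := prim_order_gt0 prim_z.
have n_div : n \in divisors n by rewrite -dvdn_divisors.
have := congr1 (map_poly (intr : int -> F)) (prod_Cyclotomic n_gt0).
rewrite rmorphB rmorph1 /= map_polyXn (prod_cyclotomic prim_z) rmorph_prod /=.
rewrite (big_rem n) //= [RHS](big_rem n) //= divnn n_gt0 expr1.
have <- : \prod_(d <- rem n (divisors n)) map_poly intr 'Phi_d
    = \prod_(d <- rem n (divisors n)) cyclotomic (z ^+ (n %/ d)) d.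
  apply: eq_big_seq => d.
  rewrite mem_rem_uniq ?divisors_uniq // inE -dvdn_divisors //.
  case/andP=> n'd d_dv_n; apply: IHn; last by rewrite dvdn_prim_root.
  by rewrite ltn_neqAle n'd dvdn_leq.
apply: mulIf; apply: monic_neq0; apply: monic_prod => d _.
by apply: monic_map; apply: Cyclotomic_monic.
Qed.

(** The remainder of [P] modulo 'Phi_n has size at most [totient n] and takes
    the value [c] at [totient n] points, so it is constant. *)
Lemma const_on_conjugates (F : numFieldType) n (z c : F) (P : {poly int}) :
    n.-primitive_root z ->
    (forall k, coprime k n -> (map_poly intr P).[z ^+ k] = c) ->
  exists a U, P = a%:P + U * 'Phi_n /\ c = a%:~R.
Proof.
move=> prim_z Pc.
have mon := Cyclotomic_monic n.
pose r := Pdiv.CommonRing.rmodp P 'Phi_n.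
pose U := Pdiv.CommonRing.rdivp P 'Phi_n.
have PE : P = U * 'Phi_n + r := Pdiv.RingMonic.rdivp_eq mon P.
have sz_r : (size r <= totient n)%N.
  by rewrite -ltnS -size_Cyclotomic Pdiv.Ring.ltn_rmodpN0 // monic_neq0.
pose s := [seq z ^+ val k | k <- enum [pred k : 'I_n | coprime k n]].
have size_s : size s = totient n.
  apply: succn_inj; rewrite -(size_cyclotomic z) -(size_prod_XsubC _ id).
  by rewrite /cyclotomic /s big_map big_enum.
have uniq_s : uniq s.
  rewrite map_inj_in_uniq ?enum_uniq // => i j _ _ /eqP.
  rewrite (eq_prim_root_expr prim_z) !modn_small ?ltn_ord // => /eqP.
  exact: val_inj.
have rc x : x \in s -> (map_poly intr r).[x] = c.
  case/mapP => k; rewrite mem_enum inE => co_k ->; rewrite -(Pc k co_k) PE.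
  rewrite rmorphD rmorphM /= hornerD hornerM (map_Cyclotomic prim_z).
  have /eqP-> : root (cyclotomic z n) (z ^+ k).
    by rewrite root_cyclotomic // prim_root_exp_coprime.
  by rewrite mulr0 add0r.
have r_const : map_poly intr r = c%:P.
  apply/eqP; rewrite -subr_eq0; apply/negPn/negP => nz.
  suff : (size s < totient n)%N by rewrite size_s ltnn.
  apply: leq_trans (max_poly_roots nz _ uniq_s) _.
    by apply/allP => x sx; rewrite rootE !hornerE rc ?subrr.
  rewrite (leq_trans (size_polyD _ _)) // geq_max size_polyN.
  rewrite (leq_trans (size_poly _ _)) //= size_polyC.
  by rewrite (leq_trans (leq_b1 _)) // totient_gt0 (prim_order_gt0 prim_z).
have r0 : r = (r`_0)%:P.
  apply: size1_polyC.
  rewrite -(size_map_inj_poly (intr_inj : injective (intr : int -> F))) //.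
  by rewrite r_const size_polyC leq_b1.
exists r`_0, U; split; first by rewrite addrC -r0.
by have := congr1 (fun q : {poly F} => q`_0) r_const; rewrite coef_map coefC.
Qed.

(** * The permanent of j + k over the prime field *)

Lemma Fp_intr_eq0 p (z : int) : prime p ->
  (z%:~R == 0 :> 'F_p) = (p%:Z %| z)%Z.
Proof.
move=> p_pr; rewrite {1}[z]intEsign rmorphM rmorph_sign /= mulrI_eq0; last first.
  by apply/lregP; rewrite signr_eq0.
by rewrite -[LHS]/((`|z|%N)%:R == 0 :> 'F_p) -(dvdn_pcharf (pchar_Fp p_pr)).
Qed.

Lemma Fp_natr_neq0 p m : prime p -> (0 < m < p)%N -> m%:R != 0 :> 'F_p.
Proof.
move=> p_pr /andP[m_gt0 m_lt].
by rewrite -(dvdn_pcharf (pchar_Fp p_pr)) gtnNdvd.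
Qed.

Lemma Fp_natr_modn p m : prime p -> (m %% p)%:R = m%:R :> 'F_p.
Proof.
move=> p_pr.
by rewrite [in RHS](divn_eq m p) natrD natrM pchar_Fp_0 // mulr0 add0r.
Qed.

Lemma Fp_fermat p (x : 'F_p) : prime p -> x != 0 -> x ^+ p.-1 = 1.
Proof.
move=> p_pr nz; apply: (mulfI nz); rewrite -exprS prednK ?prime_gt0 // mulr1.
by have := expf_card x; rewrite card_Fp.
Qed.

Lemma Fp_fact p : prime p -> (p.-1)`!%:R = -1 :> 'F_p.
Proof.
move=> p_pr; apply/eqP; rewrite -addr_eq0 natr1 -(dvdn_pcharf (pchar_Fp p_pr)).
by rewrite -Wilson // prime_gt1.
Qed.

Lemma Fp_prod_natr p : prime p -> \prod_(j < p.-1) (j.+1)%:R = -1 :> 'F_p.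
Proof.
move=> p_pr; rewrite -natr_prod -(big_mkord xpredT succn) -(Fp_fact p_pr).
by rewrite fact_prod big_add1.
Qed.

(** In degree at most p-1, only the multiples of 'X^(p-1) - 1 vanish at all
    nonzero elements.  So [Q - d] is [Q`_(p.-1)] times that one, and the constant
    terms yield [d]. *)
Lemma const_on_Fp_units p (Q : {poly 'F_p}) d : prime p ->
    (size Q <= p)%N -> (forall j : 'I_(p.-1), Q.[(j.+1)%:R] = d) ->
  d = Q`_0 + Q`_(p.-1).
Proof.
move=> p_pr sz_Q Qd; have p_gt1 := prime_gt1 p_pr.
have p1_gt0 : (0 < p.-1)%N by rewrite -ltnS prednK // ltnW.
have fermat (j : 'I_(p.-1)) : (j.+1)%:R ^+ p.-1 = 1 :> 'F_p.
  by apply: Fp_fermat; rewrite // Fp_natr_neq0 //= -ltn_predRL.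
pose S := Q - d%:P - Q`_(p.-1) *: ('X^(p.-1) - 1).
have sz_S : (size S <= p.-1)%N.
  apply/leq_sizeP => i le_i.
  rewrite !coefE; have [->|ne_i] := eqVneq i p.-1.
    by rewrite gtn_eqF //= !subr0 mulr1 subrr.
  have -> : Q`_i = 0.
    by rewrite nth_default // (leq_trans sz_Q) //; move: le_i ne_i; lia.
  by rewrite gtn_eqF ?(leq_trans p1_gt0) //= !subr0 mulr0 subrr.
pose s := [seq (val j).+1%:R : 'F_p | j <- enum 'I_(p.-1)].
have uniq_s : uniq s.
  rewrite map_inj_uniq ?enum_uniq // => i j /eqP.
  rewrite -[_ == _]/(i.+1%:R == j.+1%:R :> 'F_p) => /eqP /(congr1 val) /=.
  rewrite !val_Fp_nat // !modn_small => [[]| |]; first exact: val_inj.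
    by rewrite -ltn_predRL.
  by rewrite -ltn_predRL.
have S0 : S = 0.
  apply/eqP/negPn/negP => nz.
  have := leq_trans (max_poly_roots nz _ uniq_s) sz_S.
  rewrite size_map size_enum_ord ltnn => h; apply: notF; apply: h.
  apply/allP => _ /mapP[j _ ->]; rewrite rootE !hornerE Qd fermat.
  by rewrite !subrr mulr0 subr0.
have := congr1 (fun q : {poly 'F_p} => q`_0) S0.
rewrite !coefE eqxx [0%N == p.-1]ltn_eqF //= => /eqP.
by rewrite sub0r mulrN1 opprK addrAC subr_eq0 => /eqP.
Qed.

(** The permanent of the matrix of the t j + k, a polynomial [Q] in t of degree
    at most p-1, is the same for all nonzero t, since replacing t by t a
    permutes the rows.  So its value at t = 1 is the sum of its extreme
    coefficients ([const_on_Fp_units]), each of which is (p-1)!^2. *)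
Lemma permanent_hankel_Fp p : prime p ->
  permanent (hankel p (fun m => m%:R : 'F_p)) = 2.
Proof.
move=> p_pr; have p_gt1 := prime_gt1 p_pr.
have nz (j : 'I_(p.-1)) : (j.+1)%:R != 0 :> 'F_p.
  by rewrite Fp_natr_neq0 //= -ltn_predRL.
pose fac (s : 'S_(p.-1)) (j : 'I_(p.-1)) : {poly 'F_p} :=
  (j.+1)%:R *: 'X + ((s j).+1)%:R%:P.
pose Q : {poly 'F_p} := \sum_s \prod_j fac s j.
have QE t : Q.[t] = permanent (\matrix_(i, j < p.-1) (t * i.+1%:R + j.+1%:R)).
  rewrite /Q horner_sum; apply: eq_bigr => s _; rewrite horner_prod.
  by apply: eq_bigr => j _; rewrite !hornerE mxE mulrC.
have sz_fac s j : size (fac s j) = 2%N.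
  by rewrite size_polyDl size_scale ?nz // size_polyX // ltnS size_polyC leq_b1.
have fac_lead s j : lead_coef (fac s j) = (j.+1)%:R.
  rewrite lead_coefDl ?lead_coefZ ?lead_coefX ?mulr1 //.
  by rewrite size_scale ?nz // size_polyX // ltnS size_polyC leq_b1.
have sz_prod s : size (\prod_j fac s j) = p.
  rewrite size_prod => [|j _]; last by rewrite -size_poly_gt0 sz_fac.
  under eq_bigr do rewrite sz_fac.
  by rewrite sum_nat_const card_ord muln2 -addnn -addSn addnK prednK // ltnW.
have sz_Q : (size Q <= p)%N.
  rewrite (leq_trans (size_sum _ _ _)) //; apply/bigmax_leqP => s _.
  by rewrite sz_prod.
have top s : (\prod_j fac s j)`_(p.-1) = -1.
  have := lead_coef_prod (index_enum 'I_(p.-1)) xpredT (fac s).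
  rewrite lead_coefE sz_prod => ->; under eq_bigr do rewrite fac_lead.
  exact: Fp_prod_natr.
have bottom s : (\prod_j fac s j)`_0 = -1.
  rewrite -horner_coef0 horner_prod -(Fp_prod_natr p_pr) [RHS](reindex_perm s).
  by apply: eq_bigr => j _; rewrite !hornerE.
have sum_const (f : 'S_(p.-1) -> 'F_p) : (forall s, f s = -1) -> \sum_s f s = 1.
  move=> fE; under eq_bigr do rewrite fE.
  by rewrite sumr_const card_Sn -mulr_natr Fp_fact // mulrNN mulr1.
have coef_top : Q`_(p.-1) = 1 by rewrite coef_sum sum_const.
have coef_bot : Q`_0 = 1 by rewrite coef_sum sum_const.
have Q1 : Q.[1] = permanent (hankel p (fun m => m%:R : 'F_p)).
  by rewrite QE; congr permanent; apply/matrixP => i j; rewrite !mxE mul1r natrD.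
rewrite -Q1 (@const_on_Fp_units p Q Q.[1]) ?coef_top ?coef_bot // => a.
have co_ap : coprime a.+1 p.
  by rewrite coprime_sym prime_coprime // gtnNdvd // -ltn_predRL.
have [s sE] := mul_mod_perm p_gt1 co_ap.
rewrite !QE -[RHS](permanent_mxsub s 1%g); congr permanent.
apply/matrixP => i j; rewrite !mxE perm1 sE Fp_natr_modn // natrM mul1r //.
Qed.

(** * The constant term modulo p^2 *)

Lemma Cyclotomic_prime p : prime p -> 'Phi_p * ('X - 1) = 'X^p - 1.
Proof.
move=> p_pr; have Phi1 : 'Phi_1 = 'X - 1.
  by have := prod_Cyclotomic (isT : 0 < 1)%N; rewrite big_seq1 expr1.
have := prod_Cyclotomic (prime_gt0 p_pr).
rewrite (perm_big [:: 1%N; p]) /=; first by rewrite big_cons big_seq1 Phi1 mulrC.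
apply: uniq_perm => [||d]; rewrite ?divisors_uniq //=.
  by rewrite inE andbT neq_ltn prime_gt1.
rewrite -dvdn_divisors ?prime_gt0 // !inE; apply/idP/pred2P => [|[]->//].
by case/primeP: p_pr => _ /[apply]/pred2P.
Qed.

Lemma Cyclotomic_prime_at1 p : prime p -> ('Phi_p).[1] = p%:Z.
Proof.
move=> p_pr; have -> : 'Phi_p = \sum_(i < p) 'X^i.
  have nz : 'X - 1 != 0 :> {poly int} by rewrite -polyC1 polyXsubC_eq0.
  by apply: (mulIf nz); rewrite Cyclotomic_prime // subrX1 mulrC.
rewrite horner_sum; under eq_bigr do rewrite hornerXn expr1n.
by rewrite sumr_const card_ord natz.
Qed.

Lemma Cyclotomic_prime_Fp p : prime p ->
  map_poly intr 'Phi_p = ('X - 1) ^+ p.-1 :> {poly 'F_p}.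
Proof.
move=> p_pr; have nz : 'X - 1 != 0 :> {poly 'F_p}.
  by rewrite -polyC1 polyXsubC_eq0.
apply: (mulIf nz); rewrite -exprSr prednK ?prime_gt0 //.
have pchX : p \in [pchar {poly 'F_p}] by rewrite (rmorph_pchar polyC) ?pchar_Fp.
rewrite -(pFrobenius_autE pchX) rmorphB rmorph1 /= pFrobenius_autE.
have := congr1 (map_poly (intr : int -> 'F_p)) (Cyclotomic_prime p_pr).
by rewrite rmorphM !rmorphB /= map_polyX map_polyXn rmorph1.
Qed.

(** Two specializations of the hypothesis are compared: X = 1 determines [c] from
    [U], and reduction modulo p identifies [U] with [H] after cancelling
    'Phi_p = ('X - 1) ^+ p.-1. *)
Lemma constant_mod_Cyclotomic_prime p (c : int) (H U : {poly int}) : prime p ->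
    ('X - 1) ^+ p.-1 * H = c%:P + U * 'Phi_p ->
  (p%:Z ^+ 2 %| c + p%:Z * H.[1])%Z.
Proof.
move=> p_pr HU; have p1_gt0 : (0 < p.-1)%N.
  by rewrite -ltnS prednK ?prime_gt0 // prime_gt1.
have c_eq : c = p%:Z * - U.[1].
  have := congr1 (horner^~ 1) HU.
  rewrite !hornerE Cyclotomic_prime_at1 // subrr expr0n gtn_eqF // mul0r.
  by move/esym/eqP; rewrite addr_eq0 mulrC -mulrN => /eqP.
have HU1 : (p%:Z %| H.[1] - U.[1])%Z.
  rewrite -(Fp_intr_eq0 _ p_pr) rmorphB /= subr_eq0.
  have := congr1 (map_poly (intr : int -> 'F_p)) HU.
  rewrite rmorphD !rmorphM rmorphXn rmorphB rmorph1 /= Cyclotomic_prime_Fp //.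
  rewrite map_polyC map_polyX /=.
  have -> : c%:~R = 0 :> 'F_p.
    by apply/eqP; rewrite Fp_intr_eq0 // c_eq dvdz_mulr.
  rewrite add0r mulrC => /mulIf HUeq.
  have nz : ('X - 1) ^+ p.-1 != 0 :> {poly 'F_p}.
    by rewrite expf_eq0 negb_and -polyC1 polyXsubC_eq0 orbT.
  have := congr1 (horner^~ 1) (HUeq nz).
  by rewrite -[1 in X in X -> _](rmorph1 intr) !horner_map => /= ->.
rewrite c_eq addrC -mulrDr expr2.
by apply: dvdz_mul.
Qed.

(** * Tangents as values at roots of unity *)

(** Chosen so that i tan (pi m / n) is its value at e^(2 pi i m / n), with the factor
    'X - 1 exhibited. *)
Definition tan_poly n : {poly int} := ('X - 1) * \sum_(i < uphalf n) 'X^(i.*2).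

(** The product (X + 1) g telescopes to X^(n+1) - 1. *)
Lemma horner_tan_poly (F : fieldType) n (x : F) : odd n -> x ^+ n = 1 ->
  (x + 1) * (map_poly intr (tan_poly n)).[x] = x - 1.
Proof.
move=> n_odd xn; rewrite rmorphM rmorphB rmorph1 /= map_polyX rmorph_sum /=.
rewrite hornerM horner_sum hornerD hornerN hornerX hornerC mulrA.
under eq_bigr do rewrite map_polyXn hornerXn -mul2n exprM.
have -> : (x + 1) * (x - 1) = x ^+ 2 - 1 by ring.
rewrite -subrX1 -exprM mul2n odd_uphalfK //.
by rewrite exprS xn mulr1.
Qed.

Definition cis (R : realType) (x : R) : R[i] :=
  (cos x)%:C%C + 'i%C * (sin x)%:C%C.

Lemma cisD (R : realType) (x y : R) : cis (x + y) = cis x * cis y.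
Proof.
have i2 : ('i%C : R[i]) ^+ 2 = -1 by exact: sqr_i.
rewrite /cis cosD sinD !(rmorphB, rmorphD, rmorphM) /=.
ring: i2.
Qed.

Lemma cisMn (R : realType) (x : R) k : cis (x *+ k) = cis x ^+ k.
Proof.
elim: k => [|k IH]; first by rewrite mulr0n /cis cos0 sin0 mulr0 addr0.
by rewrite mulrSr cisD IH exprSr.
Qed.

Lemma cis_neq1 (R : realType) (x : R) : 0 < x < pi *+ 2 -> cis x != 1.
Proof.
move=> /andP[x_gt0 x_lt]; apply/negP => /eqP /(congr1 (@complex.Re R)).
rewrite /cis /=; simpc.
(* cos x = 1 - 2 sin^2 (x/2), and sin (x/2) > 0 for x/2 between 0 and pi. *)
have -> : x = (x / 2) + (x / 2) by field.
rewrite cosD /= => cos1.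
have : 0 < sin (x / 2) by apply: sin_gt0_pi; lra.
have := cos2Dsin2 (x / 2); nra.
Qed.

Lemma cis_prim (R : realType) n :
  (0 < n)%N -> n.-primitive_root (cis (pi *+ 2 / n%:R : R)).
Proof.
move=> n_gt0; have nR : (0 : R) < n%:R by rewrite ltr0n.
have E : cis (pi *+ 2 / n%:R : R) ^+ n = 1.
  rewrite -cisMn -[_ / _ *+ n]mulr_natr divfK ?gt_eqF // /cis.
  by rewrite -[pi *+ 2]add0r cosD2pi sinD2pi cos0 sin0 mulr0 addr0.
apply/andP; split => //; apply/forallP => i; apply/eqP.
rewrite unity_rootE; have [->|ne] := eqVneq i.+1 n; first by rewrite E eqxx.
apply/negbTE; rewrite -cisMn; apply: cis_neq1.
have lt_i : (i.+1 < n)%N by rewrite ltn_neqAle ne ltn_ord.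
have pi2 : 0 < pi *+ 2 :> R by rewrite mulrn_wgt0 // pi_gt0.
rewrite -[_ / _ *+ _]mulr_natr -mulrA mulr_gt0 ?mulr_gt0 ?invr_gt0 ?ltr0n //=.
by rewrite gtr_pMr // mulrC ltr_pdivrMr // mul1r ltr_nat.
Qed.

Lemma tan_cis (R : realType) (x : R) : cis (x *+ 2) != -1 ->
  (cis (x *+ 2) + 1) * ('i%C * (tan x)%:C%C) = cis (x *+ 2) - 1.
Proof.
have i2 : ('i%C : R[i]) ^+ 2 = -1 by exact: sqr_i.
have cs : (sin x)%:C%C ^+ 2 = 1 - (cos x)%:C%C ^+ 2 :> R[i].
  have := congr1 (real_complex R) (cos2Dsin2 x).
  by rewrite rmorphD !rmorphXn rmorph1 => <-; rewrite addrAC subrr add0r.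
rewrite cisMn => ne.
(* If cos x = 0 then cis x ^+ 2 = - sin x ^+ 2 = -1. *)
have c_neq0 : cos x != 0.
  apply: contra ne => /eqP c0; rewrite /cis c0 add0r exprMn i2.
  by move: cs; rewrite c0 expr0n subr0 => ->; rewrite mulr1.
have tc : (tan x)%:C%C * (cos x)%:C%C = (sin x)%:C%C :> R[i].
  by rewrite -rmorphM /tan divfK.
rewrite /cis -tc in cs *.
set t := (tan x)%:C%C in cs *; set c := (cos x)%:C%C in cs *.
ring: i2 cs.
Qed.

(** * The permanent of tangents *)

Definition tan_permanent n : {poly int} :=
  permanent (hankel n (fun m => tan_poly n \Po 'X^m)).

Lemma horner_tan_permanent (F : fieldType) n (x : F) :
  (map_poly intr (tan_permanent n)).[x] =
  permanent (hankel n (fun m => (map_poly intr (tan_poly n)).[x ^+ m])).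
Proof.
rewrite /tan_permanent -permanent_map -[LHS]/(horner_eval x _) -permanent_map.
congr permanent; apply/matrixP => i j; rewrite !mxE /= /horner_eval.
by rewrite map_comp_poly map_polyXn horner_comp hornerXn.
Qed.

(** The constant [a] is the value of [tan_permanent n] at every primitive n-th root
    of unity; [U] is kept for the study of [a] modulo p^2. *)
Lemma permanent_tan_matrix (R : realType) n : odd n -> (1 < n)%N ->
  exists a U, tan_permanent n = a%:P + U * 'Phi_n /\
    T R n = ((-1) ^+ n.-1./2 * a)%:~R.
Proof.
move=> n_odd n_gt1; have n_gt0 := ltnW n_gt1.
have := cis_prim R n_gt0; set z := cis _ => prim_z.
have zn := prim_expr_order prim_z.
have entry m : (map_poly intr (tan_poly n)).[z ^+ m]
    = 'i%C * (tan (pi * (m%:R / n%:R) : R))%:C%C.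
  have cisE : cis (pi * (m%:R / n%:R) *+ 2) = z ^+ m.
    by rewrite /z -cisMn; congr cis; ring.
  have zmn : (z ^+ m) ^+ n = 1 by rewrite exprAC zn expr1n.
  have zm_neq : z ^+ m != -1.
    apply/eqP => zm; have := zmn; rewrite zm -signr_odd n_odd expr1 => /eqP.
    by rewrite eqNr oner_eq0.
  (* The factor z ^+ m + 1 is nonzero because (-1) ^+ n is not 1. *)
  apply: (mulfI (x := z ^+ m + 1)); first by rewrite -subr_eq0 opprK in zm_neq.
  by rewrite horner_tan_poly // -cisE tan_cis ?cisE.
pose P := tan_permanent n.
have P_conj k : coprime k n -> (map_poly intr P).[z ^+ k] = (map_poly intr P).[z].
  move=> co_kn; rewrite !horner_tan_permanent.
  rewrite -[RHS](permanent_hankel_dilation n_gt1 co_kn); last first.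
    by move=> m; rewrite prim_expr_mod.
  by congr permanent; apply/matrixP => i j; rewrite !mxE exprM.
have [a [U [PE aE]]] := const_on_conjugates prim_z P_conj.
(* i ^+ n.-1 * T R n = a, and i ^+ n.-1 is a sign since n - 1 is even. *)
exists a, U; split => //; apply: complexI.
rewrite rmorph_int /= intrM rmorph_sign -aE horner_tan_permanent.
have -> : hankel n (fun m => (map_poly intr (tan_poly n)).[z ^+ m])
    = 'i%C *: map_mx (real_complex R) (tan_matrix R n).
  by apply/matrixP => i j; rewrite !mxE entry.
rewrite permanent_scale permanent_map -/(T R n) mulrA.
have <- : 'i%C ^+ n.-1 = (-1) ^+ n.-1./2 :> R[i].
  by rewrite -sqr_i -exprM mul2n even_halfK // -subn1 oddB ?n_odd.
rewrite -exprD addnn -mul2n exprM sqr_i -signr_odd.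
by rewrite -subn1 oddB // n_odd mul1r.
Qed.

Lemma tan_permanent_factor p : prime p ->
  exists H : {poly int}, tan_permanent p = ('X - 1) ^+ p.-1 * H /\
    H.[1]%:~R = 2 :> 'F_p.
Proof.
move=> p_pr.
(* The quotient of tan_poly p \Po 'X^m by 'X - 1. *)
pose h m : {poly int} :=
  (\sum_(i < m) 'X^i) * \sum_(i < uphalf p) 'X^(m * i.*2).
have sum_Xn_at1 N (e : 'I_N -> nat) : (\sum_(i < N) 'X^(e i)).[1] = N%:R :> int.
  rewrite horner_sum; under eq_bigr do rewrite hornerXn expr1n.
  by rewrite sumr_const card_ord.
exists (permanent (hankel p h)); split.
  rewrite -permanent_scale; congr permanent; apply/matrixP => i j.
  rewrite !mxE /h; move: (_ + _)%N => m.
  rewrite /tan_poly rmorphM rmorphB rmorph1 /= comp_polyX subrX1 -mulrA.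
  congr (_ * (_ * _)); rewrite rmorph_sum; apply: eq_bigr => k _ /=.
  by rewrite comp_Xn_poly exprM.
rewrite -[_.[1]]/(horner_eval 1 _) -!permanent_map.
have -> : map_mx intr (map_mx (horner_eval 1) (hankel p h))
    = (uphalf p)%:R *: hankel p (fun m => m%:R : 'F_p).
  apply/matrixP => i j; rewrite !mxE /horner_eval; move: (_ + _)%N => m.
  by rewrite hornerM !sum_Xn_at1 intrM mulrC !rmorph_nat.
have nz : (uphalf p)%:R != 0 :> 'F_p.
  by have p_gt1 := prime_gt1 p_pr; rewrite Fp_natr_neq0 //; lia.
rewrite permanent_scale permanent_hankel_Fp //.
by rewrite Fp_fermat // mul1r.
Qed.

(** With T R p = (-1)^((p-1)/2) a, the required congruence is a = - 2 p modulo p^2;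
    it follows from a = - p H(1) modulo p^2 and H(1) = 2 modulo p. *)
Theorem theorem4 (R : realType) :
  (forall n : nat, odd n -> (1 < n)%N -> T R n \is a Num.int) /\
  (forall p : nat, prime p -> odd p ->
     exists z : int, T R p = z%:~R /\
       (z = (-1) ^+ ((p + 1) %/ 2)%N * (2 * p%:Z) %[mod p%:Z ^+ 2])%Z).
Proof.
split=> [n n_odd n_gt1 | p p_pr p_odd].
  by have [a [U [_ ->]]] := permanent_tan_matrix R n_odd n_gt1; apply: intr_int.
have [a [U [PE TE]]] := permanent_tan_matrix R p_odd (prime_gt1 p_pr).
have [H [PH H1]] := tan_permanent_factor p_pr.
exists ((-1) ^+ p.-1./2 * a); split=> //; apply/eqP; rewrite eqz_mod_dvd.
have -> : ((p + 1) %/ 2 = p.-1./2.+1)%N by have := prime_gt0 p_pr; lia.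
rewrite exprS mulN1r mulNr opprK -mulrDr; apply: dvdz_mull.
have -> : a + 2 * p%:Z = a + p%:Z * H.[1] - p%:Z * (H.[1] - 2) by ring.
rewrite rpredB //.
  by apply: (constant_mod_Cyclotomic_prime p_pr (U := U)); rewrite -PH -PE.
rewrite expr2; apply: dvdz_mul => //.
by rewrite -(Fp_intr_eq0 _ p_pr) rmorphB /= H1 subrr.
Qed.
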